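(* There exists a lattice game on the board $\mathbb{N}^3$ with normal play (that is, with no defeated positions, $\mathcal D=\emptyset$) which has no rational strategy: its set $\mathcal P$ of $\mathrm{P}$-positions does not have a rational generating function $\sum_{p\in\mathcal P}x^p\in\mathbb{Z}[[x_1,x_2,x_3]]$.
   Context: A lattice game on $\mathbb{N}^3$ is specified by (1) a finite set $\mathcal D\subseteq\mathbb{N}^3$ of defeated positions such that the board $\mathcal B:=\mathbb{N}^3\setminus\mathcal D$ satisfies $\mathcal B+\mathbb{N}^3\subseteq\mathcal B$; and (2) a ruleset $\Gamma\subseteq\mathbb{Z}^3$, a finite set satisfying: (i) (pointedness) there is a linear functional $\varphi:\mathbb{R}^3\to\mathbb{R}$ with $\varphi(\gamma)>0$ for all $\gamma\in\Gamma$ and $\varphi(e_i)>0$ for $i=1,2,3$; (ii) (tangent cone axiom) for each ray $\rho=\mathbb{R}_{\ge0}e_i$ of $\mathbb{R}^3_{\ge0}$ there is $\gamma\in\Gamma$ with $-\gamma\in\mathbb{R}^3_{\ge0}+\mathbb{R}e_i$ (i.e. $\gamma_j\le0$ for all $j\ne i$). The positions are the elements of $\mathcal B$; the options of $p\in\mathcal B$ are the points $p-\gamma$ with $\gamma\in\Gamma$ and $p-\gamma\in\mathcal B$. Outcomes are defined by induction on $\varphi$: $p$ is a $\mathrm{P}$-position if none of its options is a $\mathrm{P}$-position, and an $\mathrm{N}$-position otherwise. Normal play means $\mathcal D=\emptyset$. The game has a rational strategy if the generating function $\sum_{p\in\mathcal P}x^p$ of its set $\mathcal P$ of $\mathrm{P}$-positions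 is a rational function of $x_1,x_2,x_3$ (equivalently, $\mathcal P$ is a finite disjoint union of intersections of rational polyhedra with translates of sublattices of $\mathbb{Z}^3$). *)

(* Defs.v *)
From HB Require Import structures.
From mathcomp Require Import all_boot all_order all_algebra.
Set Implicit Arguments. Unset Strict Implicit. Unset Printing Implicit Defensive.
Import Order.TTheory GRing.Theory Num.Theory.
Local Open Scope ring_scope.

Definition N3 := (nat * nat * nat)%type.
Definition Z3 := (int * int * int)%type.

Definition c1 (p : N3) : nat := p.1.1.
Definition c2 (p : N3) : nat := p.1.2.
Definition c3 (p : N3) : nat := p.2.
Definition g1 (g : Z3) : int := g.1.1.
Definition g2 (g : Z3) : int := g.1.2.
Definition g3 (g : Z3) : int := g.2.

Definition pointed (Gamma : seq Z3) : Prop :=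
  exists a b c : rat, 0 < a /\ 0 < b /\ 0 < c /\
    forall g, g \in Gamma ->
      0 < a * (g1 g)%:~R + b * (g2 g)%:~R + c * (g3 g)%:~R.

Definition tangent_cone (Gamma : seq Z3) : Prop :=
  (exists2 g, g \in Gamma & (g2 g <= 0) /\ (g3 g <= 0)) /\
  (exists2 g, g \in Gamma & (g1 g <= 0) /\ (g3 g <= 0)) /\
  (exists2 g, g \in Gamma & (g1 g <= 0) /\ (g2 g <= 0)).

Definition ruleset (Gamma : seq Z3) : Prop := pointed Gamma /\ tangent_cone Gamma.

Definition is_option (Gamma : seq Z3) (p q : N3) : Prop :=
  exists2 g, g \in Gamma &
    [/\ (c1 q)%:Z = (c1 p)%:Z - g1 g,
        (c2 q)%:Z = (c2 p)%:Z - g2 g &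
        (c3 q)%:Z = (c3 p)%:Z - g3 g].

(* P is the set of P-positions: p is a P-position iff none of its options
   is a P-position (the inductive definition of outcomes, phrased as the
   fixed-point equation it determines; unique by pointedness). *)
Definition P_positions (Gamma : seq Z3) (P : pred N3) : Prop :=
  forall p : N3, P p <-> (forall q, is_option Gamma p q -> ~~ P q).

(* Formal power series in x1,x2,x3 with rational coefficients: N3 -> rat.
   A polynomial is such a series with finite support. *)
Definition is_poly (Q : N3 -> rat) : Prop :=
  exists d : nat, forall p : N3,
    (d < c1 p)%N \/ (d < c2 p)%N \/ (d < c3 p)%N -> Q p = 0.

Definition ps_mul (Q f : N3 -> rat) (p : N3) : rat :=
  \sum_(i < (c1 p).+1) \sum_(j < (c2 p).+1) \sum_(k < (c3 p).+1)
     Q (nat_of_ord i, nat_of_ord j, nat_of_ord k) *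
     f ((c1 p - i)%N, (c2 p - j)%N, (c3 p - k)%N).

Definition genfun (P : pred N3) (p : N3) : rat := if P p then 1 else 0.

Definition rational_series (f : N3 -> rat) : Prop :=
  exists Q R : N3 -> rat, is_poly Q /\ is_poly R /\ (exists p, Q p != 0) /\
    forall p, ps_mul Q f p = R p.

(* Main.v *)
(** The move (a, b, 0) makes each layer z = const evaluate NOR gates, and the
    moves (0, -e, 1) let layer 0 switch off whole rows of layer 1.  On layer 0
    the P-positions are the points with y mod 17 < 3.  They switch off all rows
    of layer 1 except those with y mod 17 in {0, 7, 8, 13}; the moves that
    connect these four rows form the standard four-gate NOR circuit for XNOR,
    applied to the values at x and x - 1 of the previous row 13.  Hence
    (x, 17 t + 13, 1) is a P-position iff the binomial coefficient
    C(t, x + 1) is even.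

    If the generating function were rational, the differences
    D(x, y) = f(x, y + 17, 1) - f(x, y, 1) would satisfy a linear recurrence
    with constant coefficients.  For T = 2^m, (1 + X)^(t + T) is
    (1 + X)^t (1 + X^T) modulo 2, and for t + 1 < T the two summands do not
    overlap; so H(x, y) = D(x, y + 17 T) - D(x, y) - D(x - T, y) vanishes for
    17 <= y < 17 (T - 1).  For T large this window is longer than the
    recurrence, which forces H = 0 for all y >= 17; but
    H(T - 1, 17 (T - 1) + 13) = 2, because 1 + 1 = 0 modulo 2 only. *)
Require Import Defs.
From mathcomp Require Import all_boot all_order all_algebra.
From mathcomp Require Import zify.
From Stdlib Require Import Classical.
Set Implicit Arguments. Unset Strict Implicit. Unset Printing Implicit Defensive.
Import Order.TTheory GRing.Theory Num.Theory.
Local Open Scope ring_scope.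

(** * Outcomes as a Boolean recursion *)

(** The sign tests keep the absolute values from folding a point off the board back onto it. *)
Definition hit (P : pred N3) (p : N3) (g : Z3) : bool :=
  let u := (c1 p)%:Z - g1 g in
  let v := (c2 p)%:Z - g2 g in
  let w := (c3 p)%:Z - g3 g in
  [&& 0 <= u, 0 <= v, 0 <= w & P (`|u|%N, `|v|%N, `|w|%N)].

Lemma P_positionsP (Gamma : seq Z3) (P : pred N3) :
  P_positions Gamma P <-> (forall p, P p = ~~ has (hit P p) Gamma).
Proof.
have hitP p : reflect (exists2 q, is_option Gamma p q & P q)
                      (has (hit P p) Gamma).
  apply: (iffP hasP) => [[g gG /and4P[u v w Pq]]|[[[x y] z] [g gG [hx hy hz]] Pq]].
    by exists (`|(c1 p)%:Z - g1 g|%N, `|(c2 p)%:Z - g2 g|%N, `|(c3 p)%:Z - g3 g|%N);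
      [exists g => //; split; rewrite /c1 /c2 /c3 /= gez0_abs|].
  by exists g => //; rewrite /hit -hx -hy -hz.
split=> [PP p | PP p].
  apply/idP/negP => [/PP nP /hitP[q /nP/negP]//|nP].
  by apply/PP => q pq; apply/negP => Pq; apply/nP/hitP; exists q.
rewrite PP; split=> [/negP nP q pq|nP].
  by apply/negP => Pq; apply/nP/hitP; exists q.
by apply/negP => /hitP[q /nP/negP].
Qed.

Lemma P_positions_exist (Gamma : seq Z3) (a b c : nat) :
  (forall g, g \in Gamma -> 0 < a%:Z * g1 g + b%:Z * g2 g + c%:Z * g3 g) ->
  exists P, P_positions Gamma P.
Proof.
move=> pos.
pose weight (p : N3) := (a * c1 p + b * c2 p + c * c3 p)%N.
pose step (Q : pred N3) : pred N3 := fun p => ~~ has (hit Q p) Gamma.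
pose P_ n := iter n step xpredT.
(* Options have smaller weight, so the iterates are constant at [p] from index [weight p + 1] on. *)
have stab n m p : (weight p < n)%N -> (weight p < m)%N -> P_ n p = P_ m p.
  elim: n m p => [|n IHn] [|m] p //= ltn ltm.
  rewrite /step; congr (~~ _); apply: eq_in_has => g gG; rewrite /hit.
  set u := _ - g1 g; set v := _ - g2 g; set w := _ - g3 g.
  case: (boolP (0 <= u)) => //= u0; case: (boolP (0 <= v)) => //= v0.
  case: (boolP (0 <= w)) => //= w0.
  suff lt : (weight (`|u|, `|v|, `|w|)%N < weight p)%N.
    by apply: IHn; [exact: leq_trans lt ltn|exact: leq_trans lt ltm].
  have := pos g gG.
  rewrite -ltz_nat /weight /c1 /c2 /c3 /= !PoszD !PoszM !gez0_abs // /u /v /w /c1 /c2 /c3.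
  move: (g1 g) (g2 g) (g3 g) => x y z; lia.
exists (fun p => P_ (weight p).+1 p); apply/P_positionsP => p.
rewrite {1}/P_ /= /step; congr (~~ _); apply: eq_in_has => g gG; rewrite /hit.
set u := _ - g1 g; set v := _ - g2 g; set w := _ - g3 g.
case: (boolP (0 <= u)) => //= u0; case: (boolP (0 <= v)) => //= v0.
case: (boolP (0 <= w)) => //= w0.
suff lt : (weight (`|u|, `|v|, `|w|)%N < weight p)%N by exact: (stab _ _ _ lt (ltnSn _)).
have := pos g gG.
rewrite -ltz_nat /weight /c1 /c2 /c3 /= !PoszD !PoszM !gez0_abs // /u /v /w /c1 /c2 /c3.
move: (g1 g) (g2 g) (g3 g) => x y z; lia.
Qed.

Lemma hit_sub (P : pred N3) (x y z a b c : nat) :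
  hit P (x, y, z) (a%:Z, b%:Z, c%:Z) =
  [&& (a <= x)%N, (b <= y)%N, (c <= z)%N & P (x - a, y - b, z - c)%N].
Proof.
rewrite /hit /c1 /c2 /c3 /g1 /g2 /g3 /= !subr_ge0 !lez_nat.
case: leqP => //= ax; case: leqP => //= by_; case: leqP => //= cz.
by rewrite !subzn.
Qed.

Lemma hit_subN (P : pred N3) (x y z a b c : nat) :
  hit P (x, y, z) (a%:Z, - b%:Z, c%:Z) =
  [&& (a <= x)%N, (c <= z)%N & P (x - a, y + b, z - c)%N].
Proof.
rewrite /hit /c1 /c2 /c3 /g1 /g2 /g3 /= opprK -PoszD !subr_ge0 !lez_nat leq0n.
case: leqP => //= ax; case: leqP => //= cz.
by rewrite !subzn.
Qed.

(** * The rules, and layers 0 and 1 *)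

(** On layer 1, shifts 4 and 11 with first entry 0 feed a to rows 0 and 7, shifts 4 and 12 with
    first entry 1 feed b to rows 0 and 8, shifts 7 and 8 carry row 0 to rows 7 and 8, and 6 and 5
    carry these to row 13. Shifts 3 and 14 complete the covering of rows 3 to 16 on layer 0. The
    move (1, -3, 0) serves the tangent cone axiom along the first axis and joins no two live
    rows. *)
Definition xnor_rules : seq Z3 :=
  [seq (0%:Z, b%:Z, 0%:Z) | b <- [:: 3; 4; 5; 6; 7; 8; 11; 14]%N] ++
  [seq (1%:Z, b%:Z, 0%:Z) | b <- [:: 4; 12]%N] ++
  [:: (1%:Z, - 3%:Z, 0%:Z)] ++
  [seq (0%:Z, - e%:Z, 1%:Z) | e <- [:: 3; 7; 8; 13; 16]%N].

Lemma xnor_rules_pos g : g \in xnor_rules -> 0 < 4%:Z * g1 g + 1%:Z * g2 g + 17%:Z * g3 g.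
Proof. by move: g; apply/allP. Qed.

Lemma ruleset_xnor : ruleset xnor_rules.
Proof.
split.
  exists 4, 1, 17; split=> //; split=> //; split=> // g /xnor_rules_pos.
  by rewrite -(ltr_int rat) !rmorphD !rmorphM.
split; last split.
- by exists (1%:Z, - 3%:Z, 0%:Z).
- by exists (0%:Z, 3%:Z, 0%:Z).
- by exists (0%:Z, - 3%:Z, 1%:Z).
Qed.

Definition oddbin (t j : nat) : bool := odd 'C(t, j).

Lemma oddbin0S j : oddbin 0 j.+1 = false. Proof. by rewrite /oddbin bin0n. Qed.

Lemma oddbinn0 t : oddbin t 0 = true. Proof. by rewrite /oddbin bin0. Qed.

Lemma oddbinSS t j : oddbin t.+1 j.+1 = oddbin t j.+1 (+) oddbin t j.
Proof. by rewrite /oddbin binS oddD. Qed.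

(* [a] and [b] are the values of row 13 one period earlier, at [x] and [x - 1];
   at [x = 0] the latter point is off the board, in accordance with
   [w t.-1 0 = true].  Rows 0, 7, 8, 13 are the gates NOR(a, b), NOR(a, row 0),
   NOR(b, row 0) and NOR(row 7, row 8). *)
Definition xnor_row (w : nat -> nat -> bool) (x t r : nat) : bool :=
  let a := (0 < t)%N && ~~ w t.-1 x.+1 in
  let b := (0 < t)%N && ~~ w t.-1 x in
  match r with
  | 0 => ~~ a && ~~ b
  | 7 => ~~ a && b
  | 8 => a && ~~ b
  | 13 => ~~ w t x.+1
  | _ => false
  end%N.

Section Layers.
Variables (P : pred N3) (PP : P_positions xnor_rules P).

Lemma P_rec x y z :
  P (x, y, z) = ~~
  ([|| has (fun b => (b <= y)%N && P (x, y - b, z)%N) [:: 3; 4; 5; 6; 7; 8; 11; 14]%N,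
     has (fun b => [&& (0 < x)%N, (b <= y)%N & P (x.-1, y - b, z)%N]) [:: 4; 12]%N,
     (0 < x)%N && P (x.-1, y + 3, z)%N |
     (0 < z)%N && has (fun e => P (x, y + e, z.-1)%N) [:: 3; 7; 8; 13; 16]%N]).
Proof.
rewrite {1}(iffLR (P_positionsP xnor_rules P) PP) /xnor_rules !has_cat !has_map; congr (~~ _).
congr orb; last congr orb; last congr orb.
- by apply: eq_has => b; rewrite /= hit_sub !leq0n /= !subn0 //.
- by rewrite /= !hit_sub /= !subn0 !subn1 !orbF.
- by rewrite /= orbF hit_subN subn0 subn1.
- rewrite -[RHS]/(_ && has _ _).
  case: z => [|z]; first by rewrite [RHS]/=; apply/negbTE/hasPn => e _; rewrite /= hit_subN.
  by apply: eq_has => e /=; rewrite hit_subN /= !subn0 subn1.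
Qed.

(** Moves inside a layer lower 4x + y, so the recursion has one solution. Writing y = 17 t + r makes
    it computable for each numeral r. *)
Lemma layer_ind (row : nat -> nat -> nat -> bool) z :
  (forall x t r, (r < 17)%N ->
    let prev x b := if (b <= r)%N then row x t (r - b)%N
      else if t is t'.+1 then row x t' (17 + r - b)%N else false in
    row x t r = ~~
      ([|| has (prev x) [:: 3; 4; 5; 6; 7; 8; 11; 14]%N,
       (if x is x'.+1 then has (prev x') [:: 4; 12]%N else false),
       (if x is x'.+1 then
          if (r + 3 < 17)%N then row x' t (r + 3)%N else row x' t.+1 (r + 3 - 17)%N
        else false) |
       (0 < z)%N && has (fun e => P (x, t * 17 + r + e, z.-1)%N) [:: 3; 7; 8; 13; 16]%N])) ->
  forall x y, P (x, y, z) = row x (y %/ 17)%N (y %% 17)%N.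
Proof.
move=> rowE x y; have [n] := ubnP (4 * x + y)%N.
elim: n x y => // n IHn x y le_n.
have r17 : (y %% 17 < 17)%N by rewrite ltn_mod.
rewrite P_rec rowE //; congr (~~ _).
have prevE x' b : (0 < b <= 17)%N -> (4 * x' <= 4 * x)%N ->
    (b <= y)%N && P (x', y - b, z)%N =
    (if (b <= y %% 17)%N then row x' (y %/ 17)%N (y %% 17 - b)%N
      else if (y %/ 17)%N is t'.+1 then row x' t' (17 + y %% 17 - b)%N else false).
  move=> b17 x'x; case: (leqP b y) => [b_y|]; last first.
    by case: ifP => [|_]; [lia|case: (posnP (y %/ 17)) => [->|]//; lia].
  rewrite andTb IHn; last lia.
  case: leqP => br.
    by congr row; lia.
  case E : (y %/ 17)%N => [|t]; first lia.
  by congr row; lia.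
congr orb; last congr orb; last congr orb.
- by apply: eq_in_has => b; rewrite !inE => bs; apply: prevE => //; lia.
- case: x {IHn} le_n prevE => [|x'] le_n prevE; first by rewrite [RHS]/=; apply/negbTE/hasPn.
  by apply: eq_in_has => b; rewrite !inE => bs; rewrite /= prevE //; lia.
- case: x {prevE} le_n => // x' le_n; rewrite ltn0Sn /= IHn; last lia.
  by case: ltnP => r3; congr row; lia.
- by rewrite -divn_eq.
Qed.

Lemma layer0 x y : P (x, y, 0%N) = (y %% 17 < 3)%N.
Proof.
apply: (@layer_ind (fun _ _ r => r < 3)%N) => {x y} x t r r17 /=.
by do 17![case: r r17 => [_|r r17] ; first by case: t => [|t]; case: x].
Qed.

(** XNOR of two complemented bits is the complement of their sum, so row 13 obeys the complemented
    Pascal rule modulo 2. *)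
Lemma layer1 x y : P (x, y, 1%N) = xnor_row oddbin x (y %/ 17) (y %% 17).
Proof.
apply: (@layer_ind (xnor_row oddbin)) => {x y} x t r r17 prev.
have maskE e : P (x, t * 17 + r + e, 1.-1)%N = ((r + e) %% 17 < 3)%N.
  by rewrite layer0 -addnA modnMDl.
rewrite (eq_has maskE) {}/prev {maskE}.
(* With [oddbin] abstracted to its edge values and Pascal's rule, each residue is a propositional
   check. *)
move: oddbin0S oddbinn0 oddbinSS; move: oddbin => w w0S wn0 wSS.
do 17![case: r r17 => [_|r r17]; first by (
  case: t => [|t]; case: x => [|x]; rewrite /= ?wSS ?wn0 ?w0S //= ?orbT //;
  repeat match goal with |- context [w ?a ?b] => case: (w a b) end)].
by [].
Qed.
End Layers.

(** * Linear recurrences from rationality *)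

Lemma ex_least (A : nat -> Prop) :
  (exists n, A n) -> exists n, A n /\ forall m, (m < n)%N -> ~ A m.
Proof.
case=> n; elim/ltn_ind: n => n IHn An.
case: (classic (exists2 m, (m < n)%N & A m)) => [[m mn Am]|no].
  exact: IHn mn Am.
by exists n; split=> // m mn Am; apply: no; exists m.
Qed.

(** Since j runs up to d whatever y is, the truncated [y - j] is a true difference throughout only
    for d <= y. *)
Definition conv (d : nat) (q h : nat -> nat -> rat) (x y : nat) : rat :=
  \sum_(i < x.+1) \sum_(j < d.+1) q i j * h (x - i)%N (y - j)%N.

(* The coefficient of [q] at its lexicographically least exponent, last index
   first, is the pivot of the recurrence. *)
Lemma conv_unique d s (q h : nat -> nat -> rat) :
  (exists j i, q i j != 0) -> (forall i j, (d < j)%N -> q i j = 0) ->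
  (forall x y, (s + d <= y)%N -> conv d q h x y = 0) ->
  (forall x y, (s <= y < s + d)%N -> h x y = 0) ->
  forall x y, (s <= y)%N -> h x y = 0.
Proof.
move=> /ex_least[j0 [/ex_least[i0 [q0 imin]] jmin]] qd rec window.
have qj i j : (j < j0)%N -> q i j = 0.
  by move=> /jmin nq; apply/eqP/negP => /negP qij; apply: nq; exists i.
have qi i : (i < i0)%N -> q i j0 = 0 by move=> /imin/negP; rewrite negbK => /eqP.
have j0d : (j0 <= d)%N by rewrite leqNgt; apply: contraNN q0 => /qd->.
move=> x y; elim/ltn_ind: y x => y IHy; elim/ltn_ind=> x IHx sy.
case: (ltnP y (s + d)) => yd; first by apply: window; rewrite sy.
(* At (x + i0, y + j0) the pivot multiplies [h x y]; the other terms have a zero coefficient or an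
   earlier value of [h]. *)
have /rec : (s + d <= y + j0)%N by rewrite (leq_trans yd) ?leq_addr.
have i0lt : (i0 < (x + i0).+1)%N by rewrite ltnS leq_addl.
have j0lt : (j0 < d.+1)%N by [].
move=> /(_ (x + i0)%N); rewrite /conv (bigD1 (Ordinal i0lt)) //= (bigD1 (Ordinal j0lt)) //=.
rewrite !addnK big1 => [|j]; last first.
  rewrite -val_eqE /= => jj0; case: (ltnP j j0) => [/qj->|j0j]; first by rewrite mul0r.
  by rewrite IHy ?mulr0 //; have := ltn_ord j; lia.
rewrite big1 => [|i]; last first.
  rewrite -val_eqE /= => ii0; apply: big1 => j _.
  case: (ltngtP j j0) => [/qj->|j0j|->]; first by rewrite mul0r.
    by rewrite IHy ?mulr0 //; have := ltn_ord j; lia.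
  case: (ltnP i i0) => [/qi->|i0i]; first by rewrite mul0r.
  by rewrite addnK IHx ?mulr0 //; have := ltn_ord i; lia.
by rewrite !addr0 => /eqP; rewrite mulf_eq0 (negbTE q0) => /eqP.
Qed.

Lemma convB d q h1 h2 x y :
  conv d q (fun x y => h1 x y - h2 x y) x y = conv d q h1 x y - conv d q h2 x y.
Proof.
rewrite /conv -sumrB; apply: eq_bigr => i _; rewrite -sumrB.
by apply: eq_bigr => j _; rewrite mulrBr.
Qed.

Lemma conv_shift_y d q h s x y :
  (d <= y)%N -> conv d q (fun x y => h x (y + s)%N) x y = conv d q h x (y + s).
Proof.
move=> dy; apply: eq_bigr => i _; apply: eq_bigr => j _.
by rewrite addnBAC // (leq_trans _ dy) // -ltnS.
Qed.

Lemma conv_shift_x d q (h : nat -> nat -> rat) s x y :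
  conv d q (fun x y => if (s <= x)%N then h (x - s)%N y else 0) x y =
  if (s <= x)%N then conv d q h (x - s) y else 0.
Proof.
rewrite /conv; case: leqP => sx; last first.
  by rewrite big1 // => i _; rewrite big1 // => j _; case: leqP; rewrite ?mulr0 //; lia.
have le : ((x - s).+1 <= x.+1)%N by lia.
rewrite (big_ord_widen _ (fun i => \sum_(j < d.+1) q i j * h (x - s - i)%N (y - j)%N) le).
rewrite [RHS]big_mkcond; apply: eq_bigr => i _; case: ltnP => is_.
  by apply: eq_bigr => j _; rewrite ifT 1?subnAC //; lia.
by rewrite big1 // => j _; rewrite ifF ?mulr0 //; have := ltn_ord i; lia.
Qed.

Lemma eq_conv d q h1 h2 x y :
  (forall x y, h1 x y = h2 x y) -> conv d q h1 x y = conv d q h2 x y.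
Proof. by move=> eqh; apply: eq_bigr => i _; apply: eq_bigr => j _; rewrite eqh. Qed.

(** Let k0 be the lowest nonzero slice of Q in the third variable. Degree k0 + 1 of Q F = R involves
    only layer 1 times slice k0 and layer 0 times slice k0 + 1; differencing over the period M
    cancels the latter. *)
Lemma rational_layer1 (F : N3 -> rat) M :
  (forall x y, F (x, y + M, 0)%N = F (x, y, 0%N)) -> rational_series F ->
  exists d q, [/\ exists j i, q i j != 0, forall i j, (d < j)%N -> q i j = 0 &
    forall x y, (d < y)%N ->
      conv d q (fun x y => F (x, y + M, 1)%N - F (x, y, 1)%N) x y = 0].
Proof.
move=> perF [Q [R [[dQ Q0] [[dR R0] [[[[i1 j1] k1] Q1] QF]]]]].
have /ex_least[k0 [nz kmin]] : exists k j i, Q (i, j, k) != 0 by exists k1, j1, i1.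
pose d := maxn dQ dR; exists d, (fun i j => Q (i, j, k0)).
have Qd i j k : (d < j)%N -> Q (i, j, k) = 0.
  by move=> dj; apply: Q0; right; left; apply: leq_ltn_trans dj; apply: leq_maxl.
split=> // [i j|]; first exact: Qd.
have Qk i j k : (k < k0)%N -> Q (i, j, k) = 0.
  by move=> /kmin nQ; apply/eqP/negP => /negP Qij; apply: nQ; exists j, i.
have rec x y : (d < y)%N ->
    conv d (fun i j => Q (i, j, k0)) (fun x y => F (x, y, 1%N)) x y +
    conv d (fun i j => Q (i, j, k0.+1)) (fun x y => F (x, y, 0%N)) x y = 0.
  move=> dy; have := QF (x, y, k0.+1); rewrite R0; last first.
    by right; left; apply: leq_ltn_trans dy; apply: leq_maxr.
  move=> <-; rewrite /ps_mul /conv -big_split /c1 /c2 /c3 /=.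
  apply: eq_bigr => i _; rewrite -big_split /=.
  rewrite (big_ord_widen y.+1 (fun j => Q (i : nat, j, k0) * F (x - i, y - j, 1)%N +
     Q (i : nat, j, k0.+1) * F (x - i, y - j, 0)%N)); last by lia.
  rewrite big_mkcond; apply: eq_bigr => j _; rewrite ltnS.
  rewrite !big_ord_recr big1 /= => [|k _]; last by rewrite Qk ?mul0r.
  rewrite add0r subSnn subnn; case: leqP => // dj.
  by rewrite !Qd // !mul0r addr0.
move=> x y dy.
rewrite convB (conv_shift_y _ (fun x y => F (x, y, 1%N)) M x (ltnW dy)).
have := rec x (y + M)%N; rewrite -(conv_shift_y _ (fun x y => F (x, y, 0%N)) M x (ltnW dy)).
rewrite (eq_conv _ _ _ _ perF) => /(_ (leq_trans dy (leq_addr _ _))) /eqP.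
by rewrite addr_eq0 => /eqP->; rewrite -opprD addrC rec ?oppr0.
Qed.

(** * Pascal's triangle modulo 2 under a shift by a power of two *)

Lemma oddbin_small t j : (t < j)%N -> oddbin t j = false.
Proof. by move=> tj; rewrite /oddbin bin_small. Qed.

Lemma oddbin_add2X m t j :
  oddbin (t + 2 ^ m) j = oddbin t j (+) ((2 ^ m <= j)%N && oddbin t (j - 2 ^ m)).
Proof.
elim: m t j => [|m IHm] t j.
  by rewrite addn1; case: j => [|j]; rewrite ?oddbinn0 // oddbinSS subn1.
(* Two shifts by 2^m make one by 2^(m+1); the two middle terms cancel modulo 2. *)
rewrite expnS mul2n -addnn addnA !IHm.
case: (leqP (2 ^ m + 2 ^ m) j) => le2.
  have le1 : (2 ^ m <= j)%N by lia.
  have -> : (2 ^ m <= j - 2 ^ m)%N by lia.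
  rewrite le1 /= subnDA.
  by case: (oddbin t j); case: (oddbin t (j - _)); case: (oddbin t _).
case: leqP => le1 /=; last by rewrite !addbF.
have -> : (2 ^ m <= j - 2 ^ m)%N = false by lia.
by rewrite /= addbF -addbA addbb.
Qed.

Lemma xnor_row_eq w x x' t t' r :
  w t x.+1 = w t' x'.+1 -> w t x = w t' x' -> w t.+1 x.+1 = w t'.+1 x'.+1 ->
  xnor_row w x t.+1 r = xnor_row w x' t'.+1 r.
Proof. by rewrite /xnor_row /= => -> -> ->. Qed.

(** Beyond the diagonal the binomials vanish, so a = b = 1 and only row 13 is on. *)
Lemma xnor_row_background x t r :
  (0 < t <= x)%N -> xnor_row oddbin x t r = (r == 13%N).
Proof.
case: t => // t tx; rewrite /xnor_row /= !oddbin_small; [|lia..].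
by do 14?[case: r => [|r] //].
Qed.

Section PowerOfTwo.
Variable T : nat.
Hypothesis oddbin_addT : forall t j,
  oddbin (t + T) j = oddbin t j (+) ((T <= j)%N && oddbin t (j - T)).

Lemma xnor_row_left x t r : (x.+1 < T)%N -> (0 < t)%N ->
  xnor_row oddbin x (t + T) r = xnor_row oddbin x t r.
Proof.
case: t => // t xT _; rewrite addSn.
by apply: xnor_row_eq; rewrite -?addSn oddbin_addT leqNgt ?xT ?(ltnW xT) ?addbF.
Qed.

(** This is the seam of the two copies: column T opens the shifted copy with entry 1, column T - 1
    is past the support of the first. Hence a = 0 and b = 1 for every such t. *)
Lemma xnor_row_wall t r : (0 < t < T)%N ->
  xnor_row oddbin T.-1 (t + T) r = (r == 7%N).
Proof.
case: t => // t tT; have T0 : (T.-1.+1 = T)%N by lia.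
have w_hi u : (u < T)%N -> oddbin (u + T) T.
  by move=> uT; rewrite oddbin_addT leqnn subnn oddbinn0 oddbin_small.
have w_lo : oddbin (t + T) T.-1 = false.
  by rewrite oddbin_addT oddbin_small ?ifF; case: leqP; lia.
rewrite /xnor_row addSn /= T0 w_lo -addSn !w_hi; [|lia..].
by do 14?[case: r => [|r] //].
Qed.

Lemma xnor_row_right x t r : (T <= x)%N -> (0 < t < T)%N ->
  xnor_row oddbin x (t + T) r = xnor_row oddbin (x - T) t r.
Proof.
case: t => // t Tx tT; rewrite addSn.
have w_sub u j : (u < j)%N -> (T <= j)%N -> oddbin (u + T) j = oddbin u (j - T).
  by move=> uj Tj; rewrite oddbin_addT Tj oddbin_small.
by apply: xnor_row_eq; rewrite -?addSn w_sub ?subSn //; lia.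
Qed.

End PowerOfTwo.

Definition chi (x y : nat) : rat :=
  if xnor_row oddbin x (y %/ 17) (y %% 17) then 1 else 0.

Lemma chiE x t r : (r < 17)%N ->
  chi x (17 * t + r) = if xnor_row oddbin x t r then 1 else 0.
Proof. by move=> r17; rewrite /chi [(17 * t)%N]mulnC divnMDl // modnMDl divn_small // addn0 modn_small. Qed.

(** * The contradiction *)

Theorem theorem1p1 :
  exists Gamma : seq Z3, ruleset Gamma /\
    (exists P : pred N3, P_positions Gamma P) /\
    (forall P : pred N3, P_positions Gamma P -> ~ rational_series (genfun P)).
Proof.
exists xnor_rules; split; first exact: ruleset_xnor.
split; first exact: P_positions_exist xnor_rules_pos.
move=> P PP /(@rational_layer1 _ 17)[|d [q [qn0 qd rec]]].
  by move=> x y; rewrite /genfun !(layer0 PP) modnDr.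
pose D x y := chi x (y + 17) - chi x y.
have {}rec x y : (d < y)%N -> conv d q D x y = 0.
  move=> dy; rewrite -[RHS](rec x y dy); apply: eq_conv => {dy}{}x {}y.
  by rewrite /genfun !(layer1 PP).
(* The window 17 <= y < 17 + d has t < d + 2, so this bound keeps t + 1 below T there. *)
have [T dT addT] : exists2 T, (d.+3 < T)%N & forall t j,
    oddbin (t + T) j = oddbin t j (+) ((T <= j)%N && oddbin t (j - T)).
  by exists (2 ^ d.+3)%N; [exact: ltn_expl|exact: oddbin_add2X].
pose H x y := D x (y + 17 * T)%N - D x y - (if (T <= x)%N then D (x - T)%N y else 0).
have H0 x y : (17 <= y)%N -> H x y = 0.
  apply: (conv_unique (d := d) qn0 qd) => {x y} x y; last first.
    move=> y17; rewrite /H /D (divn_eq y 17).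
    have : (0 < y %/ 17)%N by lia.
    have : (y %/ 17 < d.+2)%N by lia.
    have : (y %% 17 < 17)%N by lia.
    move: (y %/ 17)%N (y %% 17)%N => t r r17 td t0.
    have -> : (t * 17 + r = 17 * t + r)%N by lia.
    have -> : (17 * t + r + 17 * T + 17 = 17 * (t.+1 + T) + r)%N by lia.
    have -> : (17 * t + r + 17 * T = 17 * (t + T) + r)%N by lia.
    have -> : (17 * t + r + 17 = 17 * t.+1 + r)%N by lia.
    (* Left of the seam the first two differences agree; right of it the first equals the shifted
       one and the second is background; on it both vanish. *)
    rewrite !chiE //; case: (ltngtP x.+1 T) => xT.
    - have -> : (T <= x)%N = false by lia.
      by rewrite !(xnor_row_left addT) // !subrr.
    - have -> : (T <= x)%N by lia.
      rewrite !(xnor_row_right addT) ?(@xnor_row_background x); [|lia..].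
      by rewrite !(subrr, subr0).
    - have -> : (T <= x)%N = false by lia.
      have -> : x = T.-1 by lia.
      rewrite !(xnor_row_wall addT) ?xnor_row_background; [|lia..].
      by rewrite !subrr.
  (* [H] inherits the recurrence, being a combination of shifts of [D]. *)
  move=> dy.
  rewrite /H (convB _ _ (fun x y => D x (y + 17 * T)%N - D x y)) convB.
  rewrite conv_shift_y ?conv_shift_x ?rec; [|lia..].
  by rewrite subrr sub0r; case: ifP; rewrite ?rec ?oppr0 //; lia.
(* Here t + 1 = T, where the copies first overlap: C(2T, T) is even, while C(2T - 1, T) and C(T, T)
   are odd, so the two differences are 1 and -1. *)
have := H0 T.-1 (17 * T.-1 + 13)%N.
rewrite /H /D.
have -> : (17 * T.-1 + 13 + 17 * T + 17 = 17 * (T + T) + 13)%N by lia.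
have -> : (17 * T.-1 + 13 + 17 * T = 17 * (T.-1 + T) + 13)%N by lia.
have -> : (17 * T.-1 + 13 + 17 = 17 * T + 13)%N by lia.
rewrite !chiE // /xnor_row prednK; last lia.
rewrite !addT leqnn subnn !oddbinn0 (@oddbin_small T.-1); last lia.
rewrite {1 2}/oddbin binn ifF; last lia.
by move=> H1; have /eqP := H1 ltac:(lia).
Qed.
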